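(* Let $\varepsilon_{\mathrm{out}}>0$, $\lambda_0\in\mathbb{R}^m$, $R_{\mathrm d}=\|\lambda_0-\lambda^*\|>0$, and put $$k_{\mathrm{out}}:=\left\lfloor\frac{\underline L R_{\mathrm d}^2}{\varepsilon_{\mathrm{out}}}\right\rfloor,\qquad \varepsilon_{\mathrm{in}}:=\frac{1}{2\left(1+\sqrt{2L_{\mathrm p}}\,R_{\mathrm p}\right)}\,\varepsilon_{\mathrm{out}} .$$ Assume that for every $\lambda\in\mathbb{R}^m$ the point $\bar z(\lambda)\in Z$ satisfies $$\min_{z\in Z}\langle \nabla\mathcal{L}_\rho(\bar z(\lambda),\lambda),\, z-\bar z(\lambda)\rangle \ge -\left(1+\sqrt{2L_{\mathrm p}}\,R_{\mathrm p}\right)\varepsilon_{\mathrm{in}} .$$ Let $(\lambda_k)$ be generated by the inexact dual gradient method $\lambda_{k+1}=\lambda_k+\alpha_k\nabla\bar d_\rho(\lambda_k)$ with $\alpha_k\in[\underline L^{-1},L_{\mathrm d}^{-1}]$, and let $S_k=\sum_{j=0}^k\alpha_j$, $\hat\lambda_k=S_k^{-1}\sum_{j=0}^k\alpha_j\lambda_{j+1}$, $\hat z_k=S_k^{-1}\sum_{j=0}^k\alpha_j\bar z(\lambda_j)$. Then $$f^*-d_\rho(\hat\lambda_{k_{\mathrm{out}}})\le\varepsilon_{\mathrm{out}},\qquad \hat z_{k_{\mathrm{out}}}\in Z,\qquad \|A\hat z_{k_{\mathrm{out}}}-b\|\le\frac{3}{R_{\mathrm d}}\varepsilon_{\mathrm{out}},$$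 $$-\left(\frac{3\|\lambda^*\|}{R_{\mathrm d}}+\frac{9\rho}{2R_{\mathrm d}^2}\varepsilon_{\mathrm{out}}\right)\varepsilon_{\mathrm{out}}\le f(\hat z_{k_{\mathrm{out}}})-f^*\le\left(\frac12+\frac{\|\lambda_0\|^2}{2R_{\mathrm d}^2}\right)\varepsilon_{\mathrm{out}} .$$
   Context: Setting: $f:\mathbb{R}^n\to\mathbb{R}$ is convex and differentiable, $A\in\mathbb{R}^{m\times n}$ has full row rank, $b\in\mathbb{R}^m$, $Z\subset\mathbb{R}^n$ is nonempty, compact and convex, $\rho>0$; $\|\cdot\|$ and $\langle\cdot,\cdot\rangle$ are the Euclidean norm and inner product; $\lfloor\cdot\rfloor$ is the integer floor. Primal problem: $f^*=\min\{f(z): Az=b,\ z\in Z\}$. Augmented Lagrangian: $\mathcal{L}_\rho(z,\lambda)=f(z)+\langle\lambda,Az-b\rangle+\frac\rho2\|Az-b\|^2$; $\nabla\mathcal{L}_\rho$ denotes its gradient in $z$, assumed Lipschitz continuous in $z$ on $\mathbb{R}^n$ with constant $L_{\mathrm p}>0$ for each $\lambda$. $R_{\mathrm p}=\max_{z,y\in Z}\|z-y\|$. Augmented dual function: $d_\rho(\lambda)=\min_{z\in Z}\mathcal{L}_\rho(z,\lambda)$. Slater's constraint qualification is assumed, so that $f^*=\max_{\lambda}\min_{z\in Z}\{f(z)+\langle\lambda,Az-b\rangle\}$; $\lambda^*$ denotes a maximizer of this dual problem (the ordinary dual and the problem $\max_\lambda d_\rho(\lambda)$ have the same optimal value and the same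 optimal solutions). $L_{\mathrm d}=1/\rho$ and $\underline L\ge L_{\mathrm d}$ is a fixed constant. Inexact dual information: for each $\lambda$ an approximate minimizer $\bar z(\lambda)\in Z$ of $\mathcal{L}_\rho(\cdot,\lambda)$ over $Z$ is fixed, and $\nabla\bar d_\rho(\lambda):=A\bar z(\lambda)-b$ (a notation, not necessarily a gradient). *)

(* Defs.v *)
From HB Require Import structures.
From mathcomp Require Import all_boot all_order all_algebra.
From mathcomp Require Import all_classical all_reals all_analysis.

Set Implicit Arguments.
Unset Strict Implicit.
Unset Printing Implicit Defensive.

Import Order.TTheory GRing.Theory Num.Theory.
Import numFieldNormedType.Exports.

Local Open Scope classical_set_scope.
Local Open Scope ring_scope.

(* The library norm on matrices is the sup norm, hence the explicit Euclidean
   inner product and norm. The topology on 'cV[R]_n is the usual one. *)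
Definition inner (R : realType) (n : nat) (u v : 'cV[R]_n) : R :=
  \sum_(i < n) u i 0 * v i 0.

Definition enorm (R : realType) (n : nat) (u : 'cV[R]_n) : R :=
  Num.sqrt (inner u u).

Definition grad (R : realType) (n : nat) (g : 'cV[R]_n -> R) (z : 'cV[R]_n) :
    'cV[R]_n :=
  \col_i 'D_(delta_mx i 0) g z.

(* inf and sup are total in the library; under the hypotheses of
   [minval_attained] and [maxval_attained], these are a genuine min and max. *)
Definition minval (R : realType) (T : Type) (g : T -> R) (Z : set T) : R :=
  inf (g @` Z).

Definition maxval (R : realType) (T : Type) (g : T -> R) (Z : set T) : R :=
  sup (g @` Z).

Lemma minval_attained (R : realType) (T : topologicalType) (g : T -> R)
    (Z : set T) :
  Z !=set0 -> compact Z -> {within Z, continuous g} ->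
  exists z, [/\ Z z, minval g Z = g z & forall y, Z y -> g z <= g y].
Proof.
move=> Z0 cZ cg; have [z /set_mem Zz zmin] := compact_EVT_min Z0 cZ cg.
have zle y : Z y -> g z <= g y by move=> Zy; apply: zmin; exact/mem_set.
exists z; split=> //; apply/eqP; rewrite eq_le; apply/andP; split.
  by apply: ge_inf; [exists (g z) => _ [y Zy <-]; exact: zle | exists z].
by apply: lb_le_inf; [exists (g z), z | move=> _ [y Zy <-]; exact: zle].
Qed.

Lemma maxval_attained (R : realType) (T : topologicalType) (g : T -> R)
    (Z : set T) :
  Z !=set0 -> compact Z -> {within Z, continuous g} ->
  exists z, [/\ Z z, maxval g Z = g z & forall y, Z y -> g y <= g z].
Proof.
move=> Z0 cZ cg; have [z /set_mem Zz zmax] := compact_EVT_max Z0 cZ cg.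
have zge y : Z y -> g y <= g z by move=> Zy; apply: zmax; exact/mem_set.
exists z; split=> //; apply/eqP; rewrite eq_le; apply/andP; split.
  by apply: ge_sup; [exists (g z), z | move=> _ [y Zy <-]; exact: zge].
by apply: ub_le_sup; [exists (g z) => _ [y Zy <-]; exact: zge | exists z].
Qed.

Definition affine_hull (R : realType) (n : nat) (Z : set 'cV[R]_n) :
    set 'cV[R]_n :=
  [set y | exists (k : nat) (x : 'I_k -> 'cV[R]_n) (c : 'I_k -> R),
     [/\ forall i, Z (x i), \sum_(i < k) c i = 1 &
         y = \sum_(i < k) c i *: x i]].

Definition relint (R : realType) (n : nat) (Z : set 'cV[R]_n) :
    set 'cV[R]_n :=
  [set z | Z z /\
     exists2 U : set 'cV[R]_n, nbhs z U & U `&` affine_hull Z `<=` Z].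

Definition slater (R : realType) (m n : nat) (A : 'M[R]_(m, n))
    (b : 'cV[R]_m) (Z : set 'cV[R]_n) : Prop :=
  exists2 z, relint Z z & A *m z = b.

Definition primal_value (R : realType) (m n : nat) (f : 'cV[R]_n -> R)
    (A : 'M[R]_(m, n)) (b : 'cV[R]_m) (Z : set 'cV[R]_n) : R :=
  minval f [set z | A *m z = b /\ Z z].

Definition lagrangian (R : realType) (m n : nat) (f : 'cV[R]_n -> R)
    (A : 'M[R]_(m, n)) (b : 'cV[R]_m) (z : 'cV[R]_n) (lam : 'cV[R]_m) : R :=
  f z + inner lam (A *m z - b).

Definition aug_lagrangian (R : realType) (m n : nat) (f : 'cV[R]_n -> R)
    (A : 'M[R]_(m, n)) (b : 'cV[R]_m) (rho : R)
    (z : 'cV[R]_n) (lam : 'cV[R]_m) : R :=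
  f z + inner lam (A *m z - b) + rho / 2 * enorm (A *m z - b) ^+ 2.

Definition grad_aug_lagrangian (R : realType) (m n : nat) (f : 'cV[R]_n -> R)
    (A : 'M[R]_(m, n)) (b : 'cV[R]_m) (rho : R)
    (z : 'cV[R]_n) (lam : 'cV[R]_m) : 'cV[R]_n :=
  grad (fun y => aug_lagrangian f A b rho y lam) z.

Definition dual_function (R : realType) (m n : nat) (f : 'cV[R]_n -> R)
    (A : 'M[R]_(m, n)) (b : 'cV[R]_m) (Z : set 'cV[R]_n)
    (lam : 'cV[R]_m) : R :=
  minval (fun z => lagrangian f A b z lam) Z.

Definition aug_dual_function (R : realType) (m n : nat) (f : 'cV[R]_n -> R)
    (A : 'M[R]_(m, n)) (b : 'cV[R]_m) (rho : R) (Z : set 'cV[R]_n)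
    (lam : 'cV[R]_m) : R :=
  minval (fun z => aug_lagrangian f A b rho z lam) Z.

Definition diameter (R : realType) (n : nat) (Z : set 'cV[R]_n) : R :=
  maxval (fun p : 'cV[R]_n * 'cV[R]_n => enorm (p.1 - p.2)) (Z `*` Z).

Definition step_sum (R : realType) (alpha : nat -> R) (k : nat) : R :=
  \sum_(j < k.+1) alpha j.

Definition step_average (R : realType) (n : nat) (alpha : nat -> R)
    (v : nat -> 'cV[R]_n) (k : nat) : 'cV[R]_n :=
  (step_sum alpha k)^-1 *: \sum_(j < k.+1) alpha j *: v j.

(* Main.v *)
Require Import Defs.
From HB Require Import structures.
From mathcomp Require Import all_boot all_order all_algebra.
From mathcomp Require Import all_classical all_reals all_analysis.
From mathcomp Require Import ring lra.

Set Implicit Arguments.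
Unset Strict Implicit.
Unset Printing Implicit Defensive.

Import Order.TTheory GRing.Theory Num.Theory.
Import numFieldNormedType.Exports.

Local Open Scope classical_set_scope.
Local Open Scope ring_scope.

(** Strong duality at the given dual maximizer [lamstar]: let [M] be the set of
minimizers of the Lagrangian [L(., lamstar)] over [Z] and [v] the residual
[A z - b] of least norm on [M]. If [v] were nonzero, moving [lamstar] slightly
along [v] would increase the dual function, so some [z0] in [M] is feasible and
[f z0] is the primal value.

Convexity turns the inexact stationarity of [x = zbar lam], with [g = A x - b],
into
  [f x + <lam + rho g, g> - eps_out / 2 <= f z + <lam + rho g, A z - b>]
for every [z] in [Z]. With a step at most [rho], expanding
[|lam_{j+1} - lamstar|^2] and [|lam_{j+1}|^2] then bounds the weighted dual and
primal gaps at step [j] by [alpha_j eps_out / 2] plus a telescoping term, and the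
choice of [kout] makes the sum of the steps at least [Rd^2 / eps_out]. *)

(** * Euclidean inner product and norm, up to Cauchy-Schwarz and the triangle inequality *)

Section EuclideanSpace.
Context {R : realType} {n : nat}.
Implicit Types (u v w : 'cV[R]_n) (a : R).

Lemma innerC u v : inner u v = inner v u.
Proof. by apply: eq_bigr => i _; rewrite mulrC. Qed.

Lemma innerDl u v w : inner (u + v) w = inner u w + inner v w.
Proof. by rewrite -big_split; apply: eq_bigr => i _; rewrite mxE mulrDl. Qed.

Lemma innerZl a u v : inner (a *: u) v = a * inner u v.
Proof. by rewrite [RHS]mulr_sumr; apply: eq_bigr => i _; rewrite mxE mulrA. Qed.

Lemma innerDr u v w : inner u (v + w) = inner u v + inner u w.
Proof. by rewrite innerC innerDl !(innerC u). Qed.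

Lemma innerZr a u v : inner u (a *: v) = a * inner u v.
Proof. by rewrite innerC innerZl innerC. Qed.

Lemma innerNl u v : inner (- u) v = - inner u v.
Proof. by rewrite -scaleN1r innerZl mulN1r. Qed.

Lemma innerNr u v : inner u (- v) = - inner u v.
Proof. by rewrite innerC innerNl innerC. Qed.

Lemma inner0l v : inner 0 v = 0.
Proof. by rewrite -(scale0r 0) innerZl mul0r. Qed.

Lemma inner0r v : inner v 0 = 0.
Proof. by rewrite innerC inner0l. Qed.

Lemma inner_suml (I : finType) (F : I -> 'cV[R]_n) v :
  inner (\sum_i F i) v = \sum_i inner (F i) v.
Proof.
by apply: (big_morph (fun u => inner u v)) => [u w|]; rewrite (innerDl, inner0l).
Qed.

Lemma inner_ge0 u : 0 <= inner u u.
Proof. by apply: sumr_ge0 => i _; rewrite -expr2 sqr_ge0. Qed.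

Lemma inner_eq0 u : (inner u u == 0) = (u == 0).
Proof.
apply/eqP/eqP => [u0|->]; last by rewrite inner0l.
apply/matrixP => i j; rewrite !ord1 mxE; apply/eqP; rewrite -sqrf_eq0 expr2.
apply/eqP.
by apply: (psumr_eq0P _ u0) => // k _; rewrite -expr2 sqr_ge0.
Qed.

Lemma enorm_sqr u : enorm u ^+ 2 = inner u u.
Proof. by rewrite sqr_sqrtr ?inner_ge0. Qed.

Lemma enorm_ge0 u : 0 <= enorm u.
Proof. exact: sqrtr_ge0. Qed.

Lemma enormZ a u : 0 <= a -> enorm (a *: u) = a * enorm u.
Proof.
move=> a0; rewrite /enorm innerZl innerZr mulrA -expr2 sqrtrM ?sqr_ge0//.
by rewrite sqrtr_sqr ger0_norm.
Qed.

Lemma enormN u : enorm (- u) = enorm u.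
Proof. by rewrite /enorm innerNl innerNr opprK. Qed.

(** Cauchy-Schwarz: for [v] nonzero, the square norm of [<v,v> u - <u,v> v] factors as
    [<v,v> (<u,u> <v,v> - <u,v>^2)] and is nonnegative. *)
Lemma inner_le_enorm u v : inner u v <= enorm u * enorm v.
Proof.
rewrite -sqrtrM ?inner_ge0//; apply: le_trans (ler_norm _) _.
rewrite -sqrtr_sqr ler_sqrt; last by rewrite mulr_ge0 ?inner_ge0.
have [/eqP|v0] := eqVneq (inner v v) 0.
  by rewrite inner_eq0 => /eqP ->; rewrite !inner0r mulr0 expr0n.
have vgt0 : 0 < inner v v by rewrite lt_neqAle eq_sym v0 inner_ge0.
have := inner_ge0 (inner v v *: u - inner u v *: v).
rewrite !(innerDl, innerDr, innerNl, innerNr, innerZl, innerZr) (innerC v u).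
rewrite (_ : _ + _ = inner v v * (inner u u * inner v v - inner u v ^+ 2)).
  by rewrite pmulr_rge0// subr_ge0.
ring.
Qed.

Lemma enormD u v : enorm (u + v) <= enorm u + enorm v.
Proof.
rewrite -(ler_pXn2r (ltn0Sn 1)) ?nnegrE ?addr_ge0 ?enorm_ge0//.
rewrite sqrrD !enorm_sqr innerDl !innerDr (innerC v u).
by have := inner_le_enorm u v; lra.
Qed.

End EuclideanSpace.

(** * Directional derivatives and differentiability of the Lagrangians *)

Section Differentiability.
Context {R : realType} {n : nat}.

(** [grad] only collects partial derivatives; linearity of the differential recovers every direction
    from them. *)
Lemma inner_grad (g : 'cV[R]_n -> R) (z v : 'cV[R]_n) :
  differentiable g z -> inner (grad g z) v = 'D_v g z.
Proof.
move=> dg; rewrite deriveE//.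
have -> : v = \sum_(i < n) v i 0 *: delta_mx i 0 :> 'cV[R]_n.
  rewrite [LHS]matrix_sum_delta; apply: eq_bigr => i _.
  by rewrite big_ord1.
rewrite linear_sum innerC inner_suml; apply: eq_bigr => i _.
rewrite linearZ/= innerZl; congr (_ * _).
rewrite /inner (bigD1 i)//= big1 => [|j ji]; rewrite !mxE ?eqxx.
  by rewrite mul1r addr0 deriveE.
by rewrite (negbTE ji) mul0r.
Qed.

Lemma differentiable_inner (k : nat) (F G : 'cV[R]_n -> 'cV[R]_k) z :
  (forall i, differentiable (fun y => F y i 0) z) ->
  (forall i, differentiable (fun y => G y i 0) z) ->
  differentiable (fun y => inner (F y) (G y)) z.
Proof.
move=> dF dG; rewrite (_ : (fun y => _) =
    \sum_(i < k) ((fun y => F y i 0) * (fun y => G y i 0))).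
  by apply: differentiable_sum => i; exact: differentiableM.
by apply/funext => y; rewrite fct_sumE.
Qed.

Lemma differentiable_affine_coord (m : nat) (A : 'M[R]_(m, n)) (b : 'cV[R]_m)
    i z : differentiable (fun y : 'cV[R]_n => (A *m y - b) i 0) z.
Proof.
rewrite (_ : (fun y => _) =
    \sum_(j < n) (cst (A i j) * (fun y : 'cV[R]_n => y j 0)) - cst (b i 0)).
  apply: differentiableB => //; apply: differentiable_sum => j.
  by apply: differentiableM => //; exact: differentiable_coord.
by apply/funext => y; rewrite !mxE fctE/= fct_sumE; congr (_ - _).
Qed.

Lemma differentiable_inner_affine (m : nat) (A : 'M[R]_(m, n)) (b mu : 'cV[R]_m)
    z : differentiable (fun y => inner mu (A *m y - b)) z.
Proof.
apply: differentiable_inner => i //; exact: differentiable_affine_coord.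
Qed.

Lemma differentiable_sqnorm_affine (m : nat) (A : 'M[R]_(m, n)) (b : 'cV[R]_m)
    z : differentiable (fun y => inner (A *m y - b) (A *m y - b)) z.
Proof. by apply: differentiable_inner => i; exact: differentiable_affine_coord. Qed.

Lemma differentiable_lagrangian (m : nat) (f : 'cV[R]_n -> R) (A : 'M[R]_(m, n))
    (b mu : 'cV[R]_m) z :
  differentiable f z -> differentiable (fun y => lagrangian f A b y mu) z.
Proof.
by move=> df; apply: differentiableD => //; exact: differentiable_inner_affine.
Qed.

Lemma differentiable_aug_lagrangian (m : nat) (f : 'cV[R]_n -> R)
    (A : 'M[R]_(m, n)) (b mu : 'cV[R]_m) rho z :
  differentiable f z -> differentiable (fun y => aug_lagrangian f A b rho y mu) z.
Proof.
move=> df; apply: differentiableD; first exact: differentiable_lagrangian.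
apply: differentiableM => //.
under eq_fun do rewrite enorm_sqr.
exact: differentiable_sqnorm_affine.
Qed.

End Differentiability.

(** * Two-point convexity with plain real weights *)

Section Convexity.
Context {R : realType} {n : nat}.

Lemma convex_setP (Z : set 'cV[R]_n) (x y : 'cV[R]_n) (p : R) :
  convex_set Z -> Z x -> Z y -> 0 <= p <= 1 -> Z (p *: x + (1 - p) *: y).
Proof.
move=> cZ /mem_set Zx /mem_set Zy /andP[p0 p1].
by have /set_mem := cZ x y (Itv01 p0 p1) Zx Zy.
Qed.

Lemma convex_functionP (f : 'cV[R]_n -> R) (x y : 'cV[R]_n) (p : R) :
  convex_function [set: 'cV[R]_n] f -> 0 <= p <= 1 ->
  f (p *: x + (1 - p) *: y) <= p * f x + (1 - p) * f y.
Proof.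
move=> cf /andP[p0 p1].
by have := cf (Itv01 p0 p1) x y; rewrite !in_setT; apply.
Qed.

End Convexity.

(** * Weighted running averages, Jensen's inequality and telescoping *)

Section Averages.
Context {R : realType} {n : nat} (alpha : nat -> R).
Hypothesis alpha_gt0 : forall j, 0 < alpha j.

Lemma step_sum_gt0 k : 0 < step_sum alpha k.
Proof.
elim: k => [|k IH]; first by rewrite /step_sum big_ord1.
by rewrite /step_sum big_ord_recr/= addr_gt0.
Qed.

Lemma step_sum_ge a k :
  (forall j, a <= alpha j) -> k.+1%:R * a <= step_sum alpha k.
Proof.
move=> alpha_ge; rewrite mulr_natl -[k.+1 in leLHS]card_ord -sumr_const.
by apply: ler_sum => j _.
Qed.

Lemma step_averageE (v : nat -> 'cV[R]_n) k :
  step_sum alpha k *: step_average alpha v k = \sum_(j < k.+1) alpha j *: v j.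
Proof. by rewrite scalerA divff ?scale1r// gt_eqF ?step_sum_gt0. Qed.

Lemma step_average0 (v : nat -> 'cV[R]_n) : step_average alpha v 0 = v 0%N.
Proof.
rewrite /step_average /step_sum !big_ord1 scalerA mulVf ?scale1r//.
by rewrite gt_eqF.
Qed.

Lemma step_sum_mulV k :
  step_sum alpha k.+1 * (step_sum alpha k / step_sum alpha k.+1) =
  step_sum alpha k.
Proof. by rewrite mulrCA divff ?mulr1// gt_eqF ?step_sum_gt0. Qed.

Lemma step_sum_mulVC k :
  step_sum alpha k.+1 * (1 - step_sum alpha k / step_sum alpha k.+1) =
  alpha k.+1.
Proof.
rewrite mulrBr mulr1 step_sum_mulV /step_sum big_ord_recr/=.
by rewrite addrAC subrr add0r.
Qed.

(** This recursion lets two-point convexity extend to averages of any length by induction on [k]. *)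
Lemma step_averageS (v : nat -> 'cV[R]_n) k :
  let p := step_sum alpha k / step_sum alpha k.+1 in
  step_average alpha v k.+1 = p *: step_average alpha v k + (1 - p) *: v k.+1.
Proof.
move=> p; have S1 := step_sum_gt0 k.+1.
apply: (scalerI (lt0r_neq0 S1)).
rewrite step_averageE big_ord_recr/= -step_averageE scalerDr.
rewrite !(scalerA (step_sum alpha k.+1)).
by rewrite step_sum_mulV step_sum_mulVC.
Qed.

Lemma step_sum_ratio k : 0 <= step_sum alpha k / step_sum alpha k.+1 <= 1.
Proof.
have S0 := step_sum_gt0 k; have S1 := step_sum_gt0 k.+1.
apply/andP; split; first by rewrite divr_ge0// ltW.
by rewrite ler_pdivrMr// mul1r /step_sum [leRHS]big_ord_recr/= lerDl ltW.
Qed.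

Lemma convex_set_step_average (Z : set 'cV[R]_n) v k :
  convex_set Z -> (forall j, Z (v j)) -> Z (step_average alpha v k).
Proof.
move=> cZ Zv; elim: k => [|k IH]; first by rewrite step_average0.
by rewrite step_averageS; apply: convex_setP => //; exact: step_sum_ratio.
Qed.

Lemma jensen_step_average (f : 'cV[R]_n -> R) v k :
  convex_function [set: 'cV[R]_n] f ->
  step_sum alpha k * f (step_average alpha v k)
    <= \sum_(j < k.+1) alpha j * f (v j).
Proof.
move=> cf; elim: k => [|k IH].
  by rewrite step_average0 /step_sum !big_ord1.
rewrite big_ord_recr/=; apply: le_trans (lerD IH (lexx _)).
have S1 := step_sum_gt0 k.+1.
rewrite step_averageS; have := convex_functionP (step_average alpha v k)
  (v k.+1) cf (step_sum_ratio k).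
rewrite -(ler_pM2l S1) => /le_trans; apply.
rewrite mulrDr 2!(mulrA (step_sum alpha k.+1) (_ : R) (f _)).
by rewrite step_sum_mulV step_sum_mulVC.
Qed.

Lemma inner_step_average (v : nat -> 'cV[R]_n) w k :
  step_sum alpha k * inner (step_average alpha v k) w =
  \sum_(j < k.+1) alpha j * inner (v j) w.
Proof.
rewrite -innerZl step_averageE inner_suml.
by apply: eq_bigr => j _; rewrite innerZl.
Qed.

(** Here [a] is the potential of the method: a squared distance of the multiplier to a fixed
    point. *)
Lemma telescope_step_sum (x a : nat -> R) d k :
  (forall j, alpha j * x j <= alpha j * d + (a j - a j.+1) / 2) ->
  \sum_(j < k.+1) alpha j * x j <= step_sum alpha k * d + (a 0%N - a k.+1) / 2.
Proof.
move=> ax; elim: k => [|k IH]; first by rewrite /step_sum !big_ord1.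
rewrite big_ord_recr/= /step_sum [in leRHS]big_ord_recr/= -/(step_sum _ _).
by rewrite mulrDl; have := ax k.+1; lra.
Qed.

End Averages.

Lemma minval_attained_continuous {R : realType} {T : topologicalType}
    (g : T -> R) (Z : set T) :
  Z !=set0 -> compact Z -> continuous g ->
  exists z, [/\ Z z, minval g Z = g z & forall y, Z y -> g z <= g y].
Proof.
by move=> Z0 cZ cg; apply: minval_attained => //; exact: continuous_subspaceT.
Qed.

(** If [a < 0], the step [t = - a / (c - a)] satisfies [t * c <= - a], so [2 * a + t * c <= a < 0],
    a contradiction. *)
Lemma ge0_of_first_order {R : realType} (a c : R) : 0 <= c ->
  (forall t, 0 < t <= 1 -> 0 <= t * (2 * a) + t ^+ 2 * c) -> 0 <= a.
Proof.
move=> c0 H; rewrite leNgt; apply/negP => a0.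
have ca : 0 < c - a by lra.
have t0 : 0 < - a / (c - a) by rewrite divr_gt0// oppr_gt0.
have t1 : - a / (c - a) <= 1 by rewrite ler_pdivrMr// mul1r lerDr.
have := H _ (introT andP (conj t0 t1)); set t := - a / (c - a).
rewrite expr2 -mulrA -mulrDr pmulr_rge0//.
suff : t * c <= - a by lra.
by rewrite /t mulrAC ler_pdivrMr// ler_pM2l ?oppr_gt0//; lra.
Qed.

(** * Strong duality and first-order bounds for the augmented Lagrangian *)

Section Duality.
Context {R : realType} {m n : nat}.
Variables (f : 'cV[R]_n -> R) (A : 'M[R]_(m, n)) (b : 'cV[R]_m).
Hypothesis f_convex : convex_function [set: 'cV[R]_n] f.
Hypothesis f_diff : forall z, differentiable f z.

Let inner_affine_continuous (mu : 'cV[R]_m) :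
  continuous (fun z : 'cV[R]_n => inner mu (A *m z - b)).
Proof.
move=> z; apply: differentiable_continuous; exact: differentiable_inner_affine.
Qed.

Let lagrangian_continuous (mu : 'cV[R]_m) :
  continuous (fun z => lagrangian f A b z mu).
Proof.
by move=> z; apply: differentiable_continuous; exact: differentiable_lagrangian.
Qed.

Lemma affine_segment (x z : 'cV[R]_n) t :
  A *m (t *: z + (1 - t) *: x) - b = (A *m x - b) + t *: (A *m (z - x)).
Proof.
rewrite mulmxDr -!scalemxAr mulmxBr; move: (A *m z) (A *m x) => p q.
by apply/matrixP => i j; rewrite !mxE; ring.
Qed.

Lemma exists_dual_saddle_point (Z : set 'cV[R]_n) lamstar :
  Z !=set0 -> compact Z -> convex_set Z ->
  (forall mu, dual_function f A b Z mu <= dual_function f A b Z lamstar) ->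
  exists z0, [/\ Z z0, A *m z0 = b &
    forall z, Z z -> f z0 <= lagrangian f A b z lamstar].
Proof.
move=> Z0 cZ convZ dmax.
have [zm [Zzm dzm zm_min]] :=
  minval_attained_continuous Z0 cZ (@lagrangian_continuous lamstar).
rewrite -/(dual_function f A b Z lamstar) in dzm.
set d := dual_function f A b Z lamstar in dzm dmax.
pose M := Z `&` [set z | lagrangian f A b z lamstar <= d].
have cM : compact M.
  apply: compact_closedI => //.
  apply: (@closed_comp _ _ (fun z => lagrangian f A b z lamstar) [set x | x <= d]).
    by move=> z _; exact: lagrangian_continuous.
  exact: closed_le.
have M0 : M !=set0 by exists zm; split=> //=; rewrite dzm.
have [z0 [[Zz0 Lz0] _ z0_min]] := minval_attained_continuous M0 cM
  (fun z => differentiable_continuous (differentiable_sqnorm_affine A b z)).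
have Ld z : Z z -> d <= lagrangian f A b z lamstar.
  by move=> Zz; rewrite dzm; exact: zm_min.
have [v vE] : exists v, v = A *m z0 - b by eexists.
rewrite -vE in z0_min.
suff /eqP v0 : v == 0.
  exists z0; split=> //; first by apply/eqP; rewrite -subr_eq0 -vE; apply/eqP.
  move=> z Zz; apply: le_trans (Ld z Zz).
  by move: Lz0; rewrite /= /lagrangian -vE v0 inner0r addr0.
apply: contrapT => /negP v_neq0.
have vgt0 : 0 < inner v v by rewrite lt_neqAle eq_sym inner_eq0 v_neq0 inner_ge0.
(* [v] is the residual closest to [0] on the set [M] of minimizers. *)
have vM z : M z -> inner v v <= inner v (A *m z - b).
  move=> [Zz Lz]; have -> : A *m z - b = v + A *m (z - z0).
    by rewrite vE mulmxBr [RHS]addrC addrA addrNK.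
  (* Projection inequality: the segment from [z0] to [z] stays in [M] by convexity, and along it the
     squared residual norm is quadratic in [t] and minimal at [t = 0]. *)
  rewrite innerDr lerDl; apply: (@ge0_of_first_order _ _
    (inner (A *m (z - z0)) (A *m (z - z0)))); first exact: inner_ge0.
  move=> t /andP[/ltW t0 t1]; have t01 : 0 <= t <= 1 by rewrite t0.
  have /z0_min : M (t *: z + (1 - t) *: z0).
    split; first exact: convex_setP.
    move: Lz Lz0; rewrite /= /lagrangian affine_segment -vE => Lz Lz0.
    have := convex_functionP z z0 f_convex t01.
    rewrite mulmxBr (_ : _ - A *m z0 = (A *m z - b) - v); last first.
      by rewrite vE opprB addrA addrNK.
    move: (A *m z - b) Lz => h Lz; rewrite !(innerDr, innerZr, innerNr).
    have t1' : 0 <= 1 - t by rewrite subr_ge0.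
    have := ler_wpM2l t0 Lz; have := ler_wpM2l t1' Lz0.
    by lra.
  rewrite affine_segment -vE !(innerDl, innerDr, innerZl, innerZr).
  by rewrite (innerC _ v) expr2; lra.
(* By [vM], [U] misses [M], so compactness yields a uniform gap [dl] above [d] on [U]. Off [U],
   moving the multiplier along [v] strictly raises the Lagrangian. *)
pose U := Z `&` [set z | inner v (A *m z - b) <= inner v v / 2].
have cU : compact U.
  apply: compact_closedI => //.
  apply: (@closed_comp _ _ (fun z => inner v (A *m z - b))
    [set x | x <= inner v v / 2]).
    by move=> z _; exact: inner_affine_continuous.
  exact: closed_le.
have [dl dl0 Udl] : exists2 dl : R, 0 < dl &
    forall z, U z -> d + dl <= lagrangian f A b z lamstar.
  have [U0|/nonemptyPn U0] := pselect (U !=set0); last first.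
    by exists 1 => // z; rewrite U0.
  have [zU [[ZzU vzU] _ zU_min]] :=
    minval_attained_continuous U0 cU (@lagrangian_continuous lamstar).
  exists (lagrangian f A b zU lamstar - d) => [|z Uz].
    rewrite subr_gt0 ltNge; apply/negP => zUd.
    have := vM zU (conj ZzU zUd); move: vzU => /=; lra.
  by rewrite addrCA subrr addr0; exact: zU_min.
have [zc [_ _ zc_min]] := minval_attained_continuous Z0 cZ
  (@inner_affine_continuous v).
set c := inner v (A *m zc - b) in zc_min.
have c1 : 0 < `|c| + 1 by rewrite ltr_wpDl.
(* With this step, the loss on [U] is at most [t * |c| = dl - t], so a gain of at least [t] over [d]
   remains. *)
pose t := dl / (`|c| + 1).
have t0 : 0 < t by rewrite divr_gt0.
have tc : t * `|c| = dl - t by rewrite /t; field; rewrite gt_eqF.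
have [zt [Zzt dzt _]] := minval_attained_continuous Z0 cZ
  (@lagrangian_continuous (lamstar + t *: v)).
have := dmax (lamstar + t *: v); rewrite /dual_function dzt; apply/negP.
rewrite -ltNge /lagrangian innerDl addrA innerZl -/(lagrangian f A b zt lamstar).
(* The new dual value is at least [d + t] if [zt] lies in [U], and more than [d + t * <v,v> / 2]
   otherwise. *)
have [Ut|Ut] := lerP (inner v (A *m zt - b)) (inner v v / 2).
  have := Udl zt (conj Zzt Ut); have := zc_min _ Zzt.
  have : - `|c| <= c by rewrite lerNl -normrN ler_norm.
  by nra.
have := Ld zt Zzt; have : 0 < inner v v / 2 by lra.
by nra.
Qed.

Lemma primal_value_saddle_point (Z : set 'cV[R]_n) lamstar z0 :
  Z z0 -> A *m z0 = b ->
  (forall z, Z z -> f z0 <= lagrangian f A b z lamstar) ->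
  primal_value f A b Z = f z0.
Proof.
move=> Zz0 Az0 z0_min.
have lb : lbound (f @` [set z | A *m z = b /\ Z z]) (f z0).
  move=> _ [z [Az Zz] <-]; have := z0_min z Zz.
  by rewrite /lagrangian Az subrr inner0r addr0.
apply/eqP; rewrite eq_le; apply/andP; split.
  by apply: ge_inf; [exists (f z0) | exists z0].
by apply: lb_le_inf => //; exists (f z0), z0.
Qed.

(** The left side is the limit of difference quotients as [t] decreases to 0. Convexity of [f]
    bounds each by the right side plus [t * rho / 2 * |A (z - x)|^2], which vanishes in the
    limit. *)
Lemma grad_aug_lagrangian_le rho x z mu :
  inner (grad_aug_lagrangian f A b rho x mu) (z - x)
    <= f z - f x + inner (mu + rho *: (A *m x - b)) (A *m (z - x)).
Proof.
have dL := differentiable_aug_lagrangian A b mu rho (f_diff x).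
rewrite inner_grad//; set B := leRHS.
set w := A *m (z - x).
have dD : derivable (fun y => aug_lagrangian f A b rho y mu) x (z - x).
  exact: diff_derivable.
have /cvg_dnbhs_at_right cvgL := dD.
have cvgB : (B + h * (rho / 2 * inner w w)) @[h --> 0^'+] --> B.
  rewrite -[X in _ --> X]addr0 -[X in _ --> _ + X](mul0r (rho / 2 * inner w w)).
  apply: cvg_at_right_filter; apply: cvgD; first exact: cvg_cst.
  by apply: cvgMl; exact: cvg_id.
apply: ler_cvg_to cvgL cvgB _.
near=> t.
have t0 : 0 < t by near: t; exact: nbhs_right_gt.
have t1 : t <= 1 by near: t; exact: nbhs_right_ltW.
have t01 : 0 <= t <= 1 by rewrite ltW.
rewrite /= -[_ *: _]/(_ * _) ler_pdivrMl//.
rewrite (_ : t *: (z - x) + x = t *: z + (1 - t) *: x); last first.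
  by rewrite scalerBr scalerBl scale1r addrAC addrA.
rewrite /aug_lagrangian !enorm_sqr affine_segment.
have := convex_functionP z x f_convex t01.
rewrite /B /w; move: (A *m (z - x)) (A *m x - b) => {}w g.
rewrite !(innerDl, innerDr, innerZl, innerZr) (innerC w g).
by lra.
Unshelve. all: by end_near.
Qed.

End Duality.

Lemma diameter_ge0 {R : realType} {n : nat} (Z : set 'cV[R]_n) :
  0 <= diameter Z.
Proof.
rewrite /diameter /maxval; set E := _ @` _.
(* Without a supremum, [sup] takes its default value 0. *)
have [supE|/sup_out ->//] := pselect (has_sup E).
have [[_ [p Zp _]] ubE] := supE.
by apply: le_trans (enorm_ge0 (p.1 - p.2)) (ub_le_sup ubE _); exists p.
Qed.

Lemma aug_lagrangianE {R : realType} {m n : nat} (f : 'cV[R]_n -> R)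
    (A : 'M[R]_(m, n)) (b : 'cV[R]_m) rho z mu :
  aug_lagrangian f A b rho z mu =
  f z + inner mu (A *m z - b) + rho / 2 * inner (A *m z - b) (A *m z - b).
Proof. by rewrite /aug_lagrangian enorm_sqr. Qed.

(** * One iteration: multiplier [l], inexact residual [g], residual [h] of a comparison point *)

Section OneStep.
Context {R : realType} {m : nat}.
Variables (rho d a : R) (l g h : 'cV[R]_m) (fz fbar : R).
Hypothesis a_range : 0 < a <= rho.
Hypothesis inexact :
  fbar + inner (l + rho *: g) g - d <= fz + inner (l + rho *: g) h.

(** Combining both hypotheses leaves the cross term [(rho - a) <g,h>]. As [a <= rho], it is at most
    [(rho - a) / 2] times [|g|^2 + |h|^2], which the terms [- rho |g|^2 - rho / 2 |h|^2] absorb,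
    leaving at most [- a / 2 |g|^2]. *)
Lemma dual_step fstar s : fstar <= fbar + inner s g ->
  a * (fstar - (fz + inner (l + a *: g) h + rho / 2 * inner h h))
  <= a * d + (enorm (l - s) ^+ 2 - enorm (l + a *: g - s) ^+ 2) / 2.
Proof.
have /andP[a0 arho] := a_range.
move: inexact; rewrite !enorm_sqr.
have hg : 0 <= (rho - a) * inner (g - h) (g - h).
  by rewrite mulr_ge0 ?inner_ge0 ?subr_ge0.
have gg : 0 <= rho * inner g g.
  by rewrite mulr_ge0 ?inner_ge0// ltW// (lt_le_trans a0).
have hh : 0 <= a * inner h h by rewrite mulr_ge0 ?inner_ge0 ?ltW.
move: hg gg hh; rewrite !(innerDl, innerDr, innerNl, innerNr, innerZl, innerZr).
rewrite (innerC g l) (innerC g s) (innerC h g) (innerC s l) => hg gg hh inx fs.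
set X := (X in a * X).
have /(ler_wpM2l (ltW a0)) :
  (* Multiplied by [a], the terms other than [d] are exactly half the decrease of the squared
     distance to [s]. *)
  X <= d - inner l g + inner s g - a / 2 * inner g g by rewrite /X; lra.
by move=> /le_trans; apply; lra.
Qed.

(** Against a feasible point the potential is the squared distance to 0 rather than to a dual
    solution; this is the source of [|lam0|^2] in the final upper bound. *)
Lemma primal_step : h = 0 ->
  a * (fbar - fz) <= a * d + (enorm l ^+ 2 - enorm (l + a *: g) ^+ 2) / 2.
Proof.
move=> h0; have /andP[a0 arho] := a_range.
move: inexact; rewrite !enorm_sqr h0 inner0r.
have gg : 0 <= (rho - a) * inner g g.
  by rewrite mulr_ge0 ?inner_ge0 ?subr_ge0.
have gg' : 0 <= a * inner g g by rewrite mulr_ge0 ?inner_ge0 ?ltW.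
rewrite !(innerDl, innerDr, innerZl, innerZr) (innerC g l) => inx.
have /(ler_wpM2l (ltW a0)) :
  fbar - fz <= d - inner l g - a / 2 * inner g g by lra.
by move=> /le_trans; apply; lra.
Qed.

End OneStep.

(** * Summation over the iterations, compared with a saddle point *)

Section DualGradientMethod.
Context {R : realType} {m n : nat}.
Variables (f : 'cV[R]_n -> R) (A : 'M[R]_(m, n)) (b : 'cV[R]_m).
Variables (Z : set 'cV[R]_n) (rho d : R) (z0 : 'cV[R]_n) (lamstar : 'cV[R]_m).
Variables (alpha : nat -> R) (lam : nat -> 'cV[R]_m) (x : nat -> 'cV[R]_n).
Hypothesis f_convex : convex_function [set: 'cV[R]_n] f.
Hypothesis alpha_range : forall j, 0 < alpha j <= rho.
Hypothesis lam_step : forall j, lam j.+1 = lam j + alpha j *: (A *m x j - b).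
Hypothesis xZ : forall j, Z (x j).
Hypothesis inexact : forall j z, Z z ->
  f (x j) + inner (lam j + rho *: (A *m x j - b)) (A *m x j - b) - d
    <= f z + inner (lam j + rho *: (A *m x j - b)) (A *m z - b).
Hypothesis z0Z : Z z0.
Hypothesis Az0 : A *m z0 = b.
Hypothesis saddle : forall z, Z z -> f z0 <= lagrangian f A b z lamstar.

Let S := step_sum alpha.
Let alpha_gt0 j : 0 < alpha j. Proof. by case/andP: (alpha_range j). Qed.

Lemma dual_telescope z k : Z z ->
  \sum_(j < k.+1) alpha j * (f z0 - aug_lagrangian f A b rho z (lam j.+1))
  <= S k * d + (enorm (lam 0%N - lamstar) ^+ 2
                - enorm (lam k.+1 - lamstar) ^+ 2) / 2.
Proof.
move=> Zz.
apply: (telescope_step_sum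
  (x := fun j => f z0 - aug_lagrangian f A b rho z (lam j.+1))
  (a := fun j => enorm (lam j - lamstar) ^+ 2)) => j.
rewrite aug_lagrangianE lam_step.
by apply: (dual_step (alpha_range j) (inexact j Zz)); exact: saddle.
Qed.

(** For fixed [z] the augmented Lagrangian is affine in the multiplier, so averaging the multipliers
    is exact; the last squared distance is dropped. *)
Lemma dual_gap z k : Z z ->
  S k * (f z0 - aug_lagrangian f A b rho z
           (step_average alpha (fun j => lam j.+1) k))
  <= S k * d + enorm (lam 0%N - lamstar) ^+ 2 / 2.
Proof.
move=> Zz; apply: le_trans (_ : _ <= _) (le_trans (dual_telescope k Zz) _).
  rewrite aug_lagrangianE; set q := rho / 2 * _.
  rewrite mulrBr !mulrDr inner_step_average// /S /step_sum !mulr_suml.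
  rewrite -!big_split -sumrB; apply: ler_sum => j _.
  by rewrite aug_lagrangianE /= -/q; lra.
by have := sqr_ge0 (enorm (lam k.+1 - lamstar)); lra.
Qed.

(** At the feasible point [z0] every summand of [dual_telescope] vanishes, which leaves a bound on
    the last squared distance. *)
Lemma dual_iterate_bound k :
  enorm (lam k.+1 - lamstar) ^+ 2
    <= enorm (lam 0%N - lamstar) ^+ 2 + 2 * (S k * d).
Proof.
have := dual_telescope k z0Z; rewrite big1 => [|j _]; first by lra.
by rewrite aug_lagrangianE Az0 subrr !inner0r mulr0 !addr0 subrr mulr0.
Qed.

Lemma primal_gap k :
  S k * (f (step_average alpha x k) - f z0) <= S k * d + enorm (lam 0%N) ^+ 2 / 2.
Proof.
have := jensen_step_average alpha_gt0 x k f_convex.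
have := sqr_ge0 (enorm (lam k.+1)).
have : \sum_(j < k.+1) alpha j * (f (x j) - f z0) <=
    S k * d + (enorm (lam 0%N) ^+ 2 - enorm (lam k.+1) ^+ 2) / 2.
  apply: (telescope_step_sum (x := fun j => f (x j) - f z0)
    (a := fun j => enorm (lam j) ^+ 2)) => j; rewrite lam_step.
  by apply: (primal_step (alpha_range j) (inexact j z0Z)); rewrite Az0 subrr.
have -> : \sum_(j < k.+1) alpha j * f (x j) =
    \sum_(j < k.+1) alpha j * (f (x j) - f z0) + S k * f z0.
  rewrite /S /step_sum mulr_suml -big_split; apply: eq_bigr => j _.
  by rewrite /= -mulrDr subrK.
by rewrite mulrBr -/(S k); lra.
Qed.

(** The updates telescope, so controlling the multipliers controls the infeasibility of the
    average. *)
Lemma residual_step_average k :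
  S k *: (A *m step_average alpha x k - b) = lam k.+1 - lam 0%N.
Proof.
rewrite scalerBr scalemxAr step_averageE// mulmx_sumr /S /step_sum scaler_suml.
rewrite -sumrB; under eq_bigr do rewrite -scalemxAr -scalerBr.
elim: k => [|k IH]; first by rewrite big_ord1 lam_step addrAC subrr add0r.
by rewrite big_ord_recr/= IH (lam_step k.+1) addrAC.
Qed.

End DualGradientMethod.

(** * Choice of the constants and the final bounds at [kout] *)

Theorem mainTheorem4 (R : realType) (m n : nat)
    (f : 'cV[R]_n -> R) (A : 'M[R]_(m, n)) (b : 'cV[R]_m)
    (Z : set 'cV[R]_n) (rho Lp Rp fstar Ld Llow : R)
    (lamstar lam0 : 'cV[R]_m) (zbar : 'cV[R]_m -> 'cV[R]_n)
    (eps_out eps_in Rd : R) (kout : nat)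
    (alpha : nat -> R) (lam : nat -> 'cV[R]_m)
    (f_convex : convex_function [set: 'cV[R]_n] f)
    (f_diff : forall z : 'cV[R]_n, differentiable f z)
    (A_full_row_rank : row_free A)
    (Z_nonempty : Z !=set0) (Z_compact : compact Z) (Z_convex : convex_set Z)
    (rho_gt0 : 0 < rho)
    (Lp_gt0 : 0 < Lp)
    (Lp_lipschitz : forall (mu : 'cV[R]_m) (z y : 'cV[R]_n),
        enorm (grad_aug_lagrangian f A b rho z mu
               - grad_aug_lagrangian f A b rho y mu) <= Lp * enorm (z - y))
    (Rp_def : Rp = diameter Z)
    (slater_cq : slater A b Z)
    (fstar_def : fstar = primal_value f A b Z)
    (lamstar_max : forall mu : 'cV[R]_m,
        dual_function f A b Z mu <= dual_function f A b Z lamstar)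
    (Ld_def : Ld = 1 / rho)
    (Llow_ge : Ld <= Llow)
    (eps_out_gt0 : 0 < eps_out)
    (Rd_def : Rd = enorm (lam0 - lamstar))
    (Rd_gt0 : 0 < Rd)
    (kout_def : kout%:Z = Num.floor (Llow * Rd ^+ 2 / eps_out))
    (eps_in_def : eps_in = 1 / (2 * (1 + Num.sqrt (2 * Lp) * Rp)) * eps_out)
    (zbar_in : forall mu : 'cV[R]_m, Z (zbar mu))
    (zbar_inexact : forall mu : 'cV[R]_m,
        minval (fun z => inner (grad_aug_lagrangian f A b rho (zbar mu) mu)
                               (z - zbar mu)) Z
        >= - ((1 + Num.sqrt (2 * Lp) * Rp) * eps_in))
    (alpha_range : forall k : nat, Llow^-1 <= alpha k <= Ld^-1)
    (lam_init : lam 0%N = lam0)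
    (lam_step : forall k : nat,
        lam k.+1 = lam k + alpha k *: (A *m zbar (lam k) - b)) :
  let lamhat := step_average alpha (fun j => lam j.+1) kout in
  let zhat := step_average alpha (fun j => zbar (lam j)) kout in
  [/\ fstar - aug_dual_function f A b rho Z lamhat <= eps_out,
      Z zhat,
      enorm (A *m zhat - b) <= 3 / Rd * eps_out
    & - ((3 * enorm lamstar / Rd + 9 * rho / (2 * Rd ^+ 2) * eps_out) * eps_out)
        <= f zhat - fstar
        <= (1 / 2 + enorm lam0 ^+ 2 / (2 * Rd ^+ 2)) * eps_out].
Proof.
move=> lamhat zhat.
have [z0 [Zz0 Az0 saddle]] :=
  exists_dual_saddle_point f_convex f_diff Z_nonempty Z_compact Z_convex lamstar_max.
have fstarE : fstar = f z0.
  by rewrite fstar_def; exact: primal_value_saddle_point saddle.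
have Ld_gt0 : 0 < Ld by rewrite Ld_def div1r invr_gt0.
have Llow_gt0 : 0 < Llow by exact: lt_le_trans Llow_ge.
have alphaP j : 0 < alpha j <= rho.
  have /andP[a1 a2] := alpha_range j.
  rewrite (lt_le_trans _ a1) ?invr_gt0//= (le_trans a2)//.
  by rewrite Ld_def div1r invrK.
have alpha_gt0 j : 0 < alpha j by case/andP: (alphaP j).
have xZ j : Z (zbar (lam j)) by exact: zbar_in.
set d := eps_out / 2.
have inexact j z : Z z ->
    f (zbar (lam j))
      + inner (lam j + rho *: (A *m zbar (lam j) - b)) (A *m zbar (lam j) - b) - d
    <= f z + inner (lam j + rho *: (A *m zbar (lam j) - b)) (A *m z - b).
  move=> Zz; set y := zbar (lam j); set g := A *m y - b.
  have dE : (1 + Num.sqrt (2 * Lp) * Rp) * eps_in = d.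
    have : 0 < 1 + Num.sqrt (2 * Lp) * Rp.
      by rewrite ltr_wpDr// mulr_ge0 ?sqrtr_ge0// Rp_def diameter_ge0.
    rewrite eps_in_def /d; move: (1 + _) => q q0; field.
    by rewrite gt_eqF.
  set G := grad_aug_lagrangian f A b rho y (lam j).
  have Gcont : continuous (fun z : 'cV[R]_n => inner G (z - y)).
    move=> w; apply: differentiable_continuous.
    under eq_fun do rewrite -[X in inner G (X - y)]mul1mx.
    exact: differentiable_inner_affine.
  have [w [_ Gw wmin]] := minval_attained_continuous Z_nonempty Z_compact Gcont.
  have := zbar_inexact (lam j); rewrite dE -/y -/G Gw => dG.
  have := grad_aug_lagrangian_le A b f_convex f_diff rho y z (lam j).
  rewrite -/G -/g (_ : A *m (z - y) = (A *m z - b) - g); last first.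
    by rewrite mulmxBr /g opprB addrA addrNK.
  have := wmin z Zz; move: (A *m z - b) g => h {}g.
  by rewrite [inner _ (h - g)]innerDr innerNr; lra.
set S := step_sum alpha kout.
have S_gt0 : 0 < S by exact: step_sum_gt0.
have Rd2 : 0 < Rd ^+ 2 by rewrite exprn_gt0.
(* [S] has [kout + 1] terms, each at least [1 / Llow], and the floor plus one exceeds
   [Llow * Rd^2 / eps_out]. *)
have S_ge : Rd ^+ 2 / eps_out <= S.
  have Sk : kout.+1%:R * Llow^-1 <= S.
    by apply: step_sum_ge => j; case/andP: (alpha_range j).
  apply: le_trans Sk; rewrite ler_pdivlMr//.
  apply: ltW; have := floorD1_gt (Llow * Rd ^+ 2 / eps_out).
  rewrite -kout_def intrD -pmulrn natr1 => k_gt.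
  by rewrite mulrC mulrA.
have SR : Rd ^+ 2 <= S * eps_out by rewrite -ler_pdivrMr.
have resid : enorm (A *m zhat - b) <= 3 / Rd * eps_out.
  have resE := residual_step_average alphaP lam_step kout.
  have := dual_iterate_bound alphaP lam_step xZ inexact Zz0 Az0 saddle kout.
  rewrite -/S lam_init -Rd_def => lamk.
  have := enormD (lam kout.+1 - lamstar) (lamstar - lam0).
  rewrite -[enorm (lamstar - _)]enormN opprB -Rd_def addrA addrNK.
  rewrite -lam_init -resE -/S -/zhat enormZ; last exact: ltW.
  set N := enorm (lam _ - _) in lamk *; set r := enorm (_ - b) => Sr.
  (* With [q = S * eps_out >= Rd^2], squaring gives [N^2 * Rd^2 <= (Rd^2 + q) * Rd^2 <= 2 * q^2].
     The constant 3 then arises from [S * r * Rd <= N * Rd + Rd^2 <= 2 * q + q]. *)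
  have N_le : N * Rd <= 2 * (S * eps_out).
    rewrite -(ler_pXn2r (ltn0Sn 1)) ?nnegrE; last 2 first.
    - by rewrite mulr_ge0 ?enorm_ge0 ?ltW.
    - by rewrite !mulr_ge0 ?ltW.
    have {}lamk : N ^+ 2 <= Rd ^+ 2 + S * eps_out by move: lamk; rewrite /d; lra.
    have q0 := mulr_gt0 S_gt0 eps_out_gt0; move: (S * eps_out) q0 lamk SR => q.
    move=> q0 lamk SR; rewrite !exprMn.
    have := ler_wpM2r (ltW Rd2) lamk; have := ler_wpM2r (ltW Rd2) SR.
    by have := ler_wpM2l (ltW q0) SR; have := sqr_ge0 q; lra.
  rewrite mulrAC ler_pdivlMr// -(ler_pM2l S_gt0) mulrA.
  by have := ler_wpM2r (ltW Rd_gt0) Sr; lra.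
split=> //.
(* The dual value is an infimum, so a lower bound on the augmented Lagrangian at every [z] in [Z]
   suffices. *)
- rewrite lerBlDr -lerBlDl; apply: lb_le_inf.
    by case: Z_nonempty => z Zz; exists (aug_lagrangian f A b rho z lamhat), z.
  move=> _ [z Zz <-].
  have := dual_gap alphaP lam_step xZ inexact saddle kout Zz.
  rewrite -/S -/lamhat lam_init -Rd_def fstarE => gap.
  rewrite lerBlDl -lerBlDr -(ler_pM2l S_gt0); apply: le_trans gap _.
  rewrite /d; lra.
- exact: convex_set_step_average.
apply/andP; split.
  (* The saddle inequality at [zhat] and Cauchy-Schwarz bound the gap below by [- |lamstar|] times
     the residual bound; the term in [rho] is nonnegative, so the stated bound follows. *)
  have := saddle _ (convex_set_step_average alpha_gt0 kout Z_convex xZ).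
  rewrite -/zhat /lagrangian -fstarE.
  have := inner_le_enorm lamstar (A *m zhat - b).
  have := ler_wpM2l (enorm_ge0 lamstar) resid.
  have : 0 <= 9 * rho / (2 * Rd ^+ 2) * eps_out * eps_out.
    by rewrite !mulr_ge0// ?invr_ge0 ?mulr_ge0// ltW.
  lra.
have := primal_gap f_convex alphaP lam_step inexact Zz0 Az0 kout.
rewrite -/S -/zhat lam_init -fstarE => gap.
rewrite -(ler_pM2l S_gt0); apply: le_trans gap _.
rewrite mulrDl mulrDr /d; suff : enorm lam0 ^+ 2 / 2 <=
  S * (enorm lam0 ^+ 2 / (2 * Rd ^+ 2) * eps_out) by lra.
(* The last factor is at least 1 by [SR]. *)
rewrite (_ : S * _ = enorm lam0 ^+ 2 / 2 * (S * eps_out / Rd ^+ 2)).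
  by rewrite ler_peMr ?divr_ge0 ?sqr_ge0// ler_pdivlMr// mul1r.
by field; rewrite gt_eqF.
Qed.
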